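(* Let $(V,\mu,\alpha)$ be a multiplicative Hom-Jordan algebra over a field $F$ with $\alpha$ invertible, and let $(V,\mu')$ be its induced Jordan algebra, $\mu'(x,y)=\alpha^{-1}(\mu(x,y))$ for all $x,y\in V$. Then $(V,\mu,\alpha)$ is solvable if and only if $(V,\mu')$ is solvable.
   Context: A Hom-Jordan algebra over a field $F$ is a triple $(V,\mu,\alpha)$ with $V$ a vector space, $\mu:V\times V\to V$ a commutative bilinear map and $\alpha:V\to V$ a linear map such that $\mu(\alpha^2(x),\mu(y,\mu(x,x)))=\mu(\mu(\alpha(x),y),\alpha(\mu(x,x)))$ for all $x,y\in V$. It is multiplicative if $\alpha(\mu(x,y))=\mu(\alpha(x),\alpha(y))$ for all $x,y\in V$. A Jordan algebra is a vector space with a commutative bilinear product $\circ$ such that $(x^2\circ y)\circ x=x^2\circ(y\circ x)$ for all $x,y$, where $x^2=x\circ x$. When $(V,\mu,\alpha)$ is multiplicative with $\alpha$ invertible, $(V,\mu')$ with $\mu'=\alpha^{-1}\circ\mu$ is a Jordan algebra, called the induced Jordan algebra. For subspaces $A,B$ of $V$, $\mu(A,B)$ denotes the span of all $\mu(a,b)$, $a\in A$, $b\in B$. The derived sequence of $(V,\mu,\alpha)$ is $V^{(1)}=\mu(V,V)$, $V^{(k)}=\mu(V^{(k-1)},V^{(k-1)})$ for $k\ge 2$; $(V,\mu,\alpha)$ is solvable if $V^{(m)}=0$ for some positive integer $m$. Solvability of $(V,\mu')$ is defined in the same way using $\mu'$ in place of $\mu$. *)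

(* Defs.v *)
From HB Require Import structures.
From mathcomp Require Import all_boot all_order all_algebra.
From mathcomp Require Import boolp classical_sets.

Set Implicit Arguments.
Unset Strict Implicit.
Unset Printing Implicit Defensive.

Import GRing.Theory.
Local Open Scope classical_set_scope.
Local Open Scope ring_scope.

Section Definitions.
Variables (F : fieldType) (V : lmodType F).

Definition hom_jordan (mu : {bilinear V -> V -> V}) (alpha : {linear V -> V}) :
    Prop :=
  commutative mu /\
  forall x y, mu (alpha (alpha x)) (mu y (mu x x)) =
              mu (mu (alpha x) y) (alpha (mu x x)).

Definition multiplicative (mu : V -> V -> V) (alpha : V -> V) : Prop :=
  forall x y, alpha (mu x y) = mu (alpha x) (alpha y).

Definition jordan (mu : {bilinear V -> V -> V}) : Prop :=
  commutative mu /\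
  forall x y, mu (mu (mu x x) y) x = mu (mu x x) (mu y x).

Definition induced_mul (mu : V -> V -> V) (alphaV : V -> V) : V -> V -> V :=
  fun x y => alphaV (mu x y).

(* [V] need not be finite-dimensional, so subspaces are classical sets rather
   than elements of [{vspace _}]. *)
Definition lin_span (S : set V) : set V :=
  [set x | exists n (c : 'I_n -> F) (v : 'I_n -> V),
             (forall i, S (v i)) /\ x = \sum_(i < n) c i *: v i].

Definition mul_span (mu : V -> V -> V) (A B : set V) : set V :=
  lin_span [set mu a b | a in A & b in B].

(* For [k >= 1] this is V^(k); the value at 0 is the whole space. *)
Definition derived_seq (mu : V -> V -> V) (k : nat) : set V :=
  iter k (fun A => mul_span mu A A) [set: V].

Definition solvable_alg (mu : V -> V -> V) : Prop :=
  exists2 m, (0 < m)%N & derived_seq mu m = [set 0].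

End Definitions.

Lemma induced_mul_jordan (F : fieldType) (V : lmodType F)
    (mu : {bilinear V -> V -> V}) (alpha : {linear V -> V}) (alphaV : V -> V) :
  hom_jordan mu alpha -> multiplicative mu alpha ->
  cancel alpha alphaV -> cancel alphaV alpha ->
  exists2 mu' : {bilinear V -> V -> V},
    mu' =2 induced_mul mu alphaV & jordan mu'.
Proof.
move=> [muC muJ] aM aK aVK.
have aVl : linear alphaV.
  by move=> c x y; apply: (can_inj aK); rewrite linearP !aVK.
have bil : bilinear_for *:%R *:%R (induced_mul mu alphaV).
  by split=> u c x y; rewrite /induced_mul ?linearPl ?linearPr aVl.
pose B := bilinear_isBilinear.Build F V V V *:%R *:%R (induced_mul mu alphaV) bil.
pose mu' : {bilinear V -> V -> V} := HB.pack (induced_mul mu alphaV) B.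
exists mu' => //.
have aVM x y : alphaV (mu x y) = mu (alphaV x) (alphaV y).
  by apply: (can_inj aK); rewrite aM !aVK.
split=> x y; rewrite /= /induced_mul; first by rewrite muC.
have := muJ (alphaV (alphaV (alphaV x))) (alphaV (alphaV y)).
rewrite !aM !aVK !aVM => muE.
rewrite [LHS]muC (muC _ (alphaV (alphaV y))) muE.
by rewrite [LHS]muC; congr (mu _ _); apply: muC.
Qed.

(* Main.v *)
Require Import Defs.
From HB Require Import structures.
From mathcomp Require Import all_boot all_order all_algebra.
From mathcomp Require Import boolp classical_sets.
Local Open Scope ring_scope.

(** The two derived sequences coincide term by term, so one vanishes exactly
    when the other does.  By multiplicativity,
      alpha^-1 (mu a b) = mu (alpha^-1 a) (alpha^-1 b)
    and
      mu a b = alpha^-1 (mu (alpha a) (alpha b)),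
    so a set A that is stable under both alpha and alpha^-1 has the same
    products for mu as for mu' ([products_induced_mul]), hence the same span of
    products.  Every term of the derived sequence is stable in this sense: the
    whole space is, and mu-products of elements of a stable set are permuted by
    the algebra automorphism alpha and by its inverse ([derived_seq_stable]). *)

Lemma cancel_linear {F : fieldType} {V : lmodType F} {f : {linear V -> V}}
    {g : V -> V} :
  cancel f g -> cancel g f -> linear g.
Proof. by move=> fK gK c x y; apply: (can_inj fK); rewrite GRing.linearP !gK. Qed.

Lemma cancel_multiplicative {F : fieldType} {V : lmodType F}
    {mu : V -> V -> V} {f g : V -> V} :
  multiplicative mu f -> cancel f g -> cancel g f -> multiplicative mu g.
Proof. by move=> fM fK gK x y; apply: (can_inj fK); rewrite fM !gK. Qed.

Lemma lin_span_stable {F : fieldType} {V : lmodType F} {f : V -> V}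
    {S : set V} :
  linear f -> (forall x, S x -> S (f x)) ->
  forall x, lin_span S x -> lin_span S (f x).
Proof.
move=> fl fS _ [n [c [v [Sv ->]]]]; exists n, c, (f \o v).
split=> [i|]; first exact/fS/Sv.
pose fL : {linear V -> V} := HB.pack f (GRing.isLinear.Build F V V *:%R f fl).
rewrite -[f]/(fL : V -> V) GRing.linear_sum.
by apply: eq_bigr => i _; rewrite GRing.linearZ.
Qed.

(** An endomorphism of the algebra sends a product of two elements of a term to
    another such product, and linearity carries this over to spans.  The lemma
    is meant for alpha and for its inverse in turn. *)
Lemma derived_seq_stable {F : fieldType} {V : lmodType F}
    {mu : V -> V -> V} {f : V -> V} :
  linear f -> multiplicative mu f ->
  forall k x, derived_seq mu k x -> derived_seq mu k (f x).
Proof.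
move=> fl fM; elim=> [//|k IHk]; apply: lin_span_stable => // _ [a Aa [b Ab <-]].
by exists (f a); [exact: IHk | exists (f b); [exact: IHk | rewrite fM]].
Qed.

(** Passing from mu to mu' only moves both factors by the inverse of [f], which
    stays inside a set stable both ways.  The sets of products already agree,
    before spans are taken. *)
Lemma products_induced_mul {F : fieldType} {V : lmodType F}
    {mu : V -> V -> V} {f g : V -> V} {A : set V} :
  multiplicative mu f -> cancel f g -> cancel g f ->
  (forall x, A x -> A (f x)) -> (forall x, A x -> A (g x)) ->
  [set induced_mul mu g a b | a in A & b in A]%classic =
  [set mu a b | a in A & b in A]%classic.
Proof.
move=> fM fK gK fA gA; have gM := cancel_multiplicative fM fK gK.
apply/seteqP; split=> _ [a Aa [b Ab <-]].
  by exists (g a); [exact: gA | exists (g b); [exact: gA | rewrite -gM]].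
exists (f a); [exact: fA | exists (f b); [exact: fA |]].
by rewrite /induced_mul -fM fK.
Qed.

Lemma derived_seq_induced_mul {F : fieldType} {V : lmodType F}
    {mu : V -> V -> V} {f : {linear V -> V}} {g : V -> V} :
  multiplicative mu f -> cancel f g -> cancel g f ->
  forall k, derived_seq (induced_mul mu g) k = derived_seq mu k.
Proof.
move=> fM fK gK; elim=> [//|k IHk].
rewrite [LHS]/derived_seq iterS -[iter k _ _]/(derived_seq _ k) IHk /mul_span.
rewrite (products_induced_mul fM fK gK) //; apply: derived_seq_stable => //.
- exact: GRing.linearP.
- exact: cancel_linear fK gK.
- exact: cancel_multiplicative fM fK gK.
Qed.

Theorem theorem3p3 (F : fieldType) (V : lmodType F)
    (mu : {bilinear V -> V -> V}) (alpha : {linear V -> V}) (alphaV : V -> V)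
    (hJ : hom_jordan mu alpha) (hM : multiplicative mu alpha)
    (alphaK : cancel alpha alphaV) (alphaVK : cancel alphaV alpha) :
  solvable_alg mu <-> solvable_alg (induced_mul mu alphaV).
Proof.
have D := derived_seq_induced_mul hM alphaK alphaVK.
by split=> -[m m_gt0 Dm]; exists m; rewrite // -Dm D.
Qed.
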